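(* Let $X$ be an $n$-dimensional normed space, let $x_1\in S(X)$ be a smooth point, and let $h\in S(X^* )$ be its supporting functional. Let $\{x_i\}_{i=2}^n\subset S(X)$ be such that $\{x_i\}_{i=1}^n$ is a basis of $X$ and $h(x_i)=0$ for $i\in\{2,\dots,n\}$. Suppose that $A$ is a sufficient enlargement for $X$ which is contained in the set $\{x\in X:\ |h(x)|\le 1\}$. Then there exists a prism $M$, symmetric with respect to $0$, with basis parallel to $\operatorname{lin}\{x_2,\dots,x_n\}$, such that (a) $M\subset A$; (b) $M$ is a sufficient enlargement for $X$.
   Context: All spaces are real. $B(X)$ and $S(X)$ denote the (closed) unit ball and the unit sphere of a normed space $X$; $X^*$ is the dual space; $\operatorname{lin}$ denotes linear span. A point $x_1\in S(X)$ is smooth if there is exactly one $h\in S(X^* )$ with $h(x_1)=1$; this $h$ is its supporting functional. A prism in an $n$-dimensional space is the Minkowski sum of a set $D$ lying in an $(n-1)$-dimensional (affine) hyperplane and a line segment that is not parallel to that hyperplane; the set $D$ is called the basis of the prism. The basis is parallel to a linear hyperplane $L$ if it lies in a translate of $L$. A ball in a finite dimensional linear space means a bounded closed convex set with nonempty interior that is symmetric with respect to $0$. A ball $A$ in a finite dimensional normed space $X$ is called a sufficient enlargement for $X$ if for every Banach space $Y$ and every isometric linear embedding of $X$ into $Y$ (identify $X$ with its image) there exists a continuous linear projection $P:Y\to X$ onto $X$ such that $P(B(Y))\subset A$. *)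

(* Defs.v *)
From HB Require Import structures.
From mathcomp Require Import all_boot all_order all_algebra.
From mathcomp Require Import all_classical all_reals all_analysis.

Set Implicit Arguments.
Unset Strict Implicit.
Unset Printing Implicit Defensive.

Import Order.TTheory GRing.Theory Num.Theory.
Import numFieldNormedType.Exports.

Local Open Scope classical_set_scope.
Local Open Scope ring_scope.

(* A finite dimensional normed space: an arbitrary norm on a vector space of
   dimension [\dim {:V}], with the topology given by that norm. *)
#[short(type="normedVectType")]
HB.structure Definition NormedVector (R : numFieldType) :=
  {V of NormedModule R V & Vector R V}.

Definition unit_ball (R : realType) (V : normedModType R) : set V :=
  [set x | `|x| <= 1].

Definition unit_sphere (R : realType) (V : normedModType R) : set V :=
  [set x | `|x| = 1].

Definition symmetric_set (R : realType) (V : normedModType R) (A : set V) :=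
  forall x, A x -> A (- x).

Section dual.
Variables (R : realType) (V : normedModType R).

(* Only meaningful for a continuous [h]: otherwise the set is unbounded and
   [sup] returns a default value. *)
Definition dual_norm (h : {linear V -> R^o}) : R :=
  sup [set `|h x| | x in @unit_ball R V].

Definition dual_sphere (h : {linear V -> R^o}) : Prop :=
  continuous h /\ dual_norm h = 1.

Definition supporting_functional (x : V) (h : {linear V -> R^o}) : Prop :=
  dual_sphere h /\ h x = 1.

Definition smooth_point (x : V) : Prop :=
  unit_sphere x /\
  exists2 h, supporting_functional x h &
    forall g, supporting_functional x g -> g =1 h.

End dual.

Section prism.
Variables (R : realType) (X : normedVectType R).

Definition translate (L : {vspace X}) (a : X) : set X :=
  [set a + y | y in [set` L]].

Definition line_segment (u v : X) : set X :=
  [set (1 - t) *: u + t *: v | t in `[0, 1]%classic].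

Definition parallel_to (D : set X) (L : {vspace X}) : Prop :=
  exists a, D `<=` translate L a.

Definition hyperplane (L : {vspace X}) : Prop :=
  (\dim L).+1 = \dim {:X}.

Definition prism_with_basis (D M : set X) : Prop :=
  exists (L : {vspace X}) (a u v : X),
    [/\ hyperplane L, D `<=` translate L a, v - u \notin L &
        M = [set d + s | d in D & s in line_segment u v]].

End prism.

Section sufficient_enlargement.
Variables (R : realType) (X : normedVectType R).

Definition symmetric_ball (A : set X) : Prop :=
  [/\ bounded_set A, closed A, convex_set A, A° !=set0 & symmetric_set A].

(* [X] is identified with its image under the isometric embedding [i], so a
   linear map [P : Y -> X] is a projection onto [X] when [P (i x) = x]. *)
Definition sufficient_enlargement (A : set X) : Prop :=
  symmetric_ball A /\
  forall (Y : completeNormedModType R) (i : {linear X -> Y}),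
    (forall x, `|i x| = `|x|) ->
    exists P : {linear Y -> X},
      [/\ continuous P, (forall x, P (i x) = x) &
          P @` (@unit_ball R Y) `<=` A].

End sufficient_enlargement.

(* Main.v *)
(* Embed X isometrically in l_infty(I) by evaluation, where I consists of the
   functionals g of norm at most 1 with g(x1) >= 0, and let P : l_infty(I) -> X
   be the projection provided by A. The functional h P has norm 1 and attains it
   at the image of x1, so it vanishes on the functions supported outside the cap
   C_k = {g | g(x1) > 1 - 1/(k+1)}. Since x1 is smooth, g converges to h
   pointwise on X when g runs in C_k and k tends to infinity. Hence, along an
   ultrafilter, L f = lim P(f 1_{I \ C_k}) and p = lim P(1_{C_k}) define a new
   projection S f = L f + f(h) p onto X, with h L = 0 and h(p) = 1. As
   P(f 1_{I \ C_k} + t 1_{C_k}) belongs to A when |f| <= 1 and |t| <= 1, the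
   image of the unit ball under S is contained in the largest prism
   D + [-p, p] contained in A with D in the kernel of h. This prism is a
   sufficient enlargement because, by Hahn-Banach on coordinates, the embedding
   of X in l_infty(I) extends with norm 1 to every space containing X. *)
Require Import Defs.
From HB Require Import structures.
From mathcomp Require Import all_boot all_order all_algebra.
From mathcomp Require Import all_classical all_reals all_analysis.
From mathcomp Require Import lra.

Set Implicit Arguments.
Unset Strict Implicit.
Unset Printing Implicit Defensive.

Import Order.TTheory GRing.Theory Num.Theory.
Import numFieldNormedType.Exports.

Local Open Scope classical_set_scope.
Local Open Scope ring_scope.

(** * The Banach space of bounded functions with the supremum norm *)

Section bounded_functions.
Variables (R : realType) (I : Type).

(** Encoded as a boolean predicate so that the subtype [linfty] inherits its module structure. *)
Definition bounded_fun : {pred I -> R^o} :=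
  [pred f | `[< exists M, forall i, `|f i| <= M >]].

Lemma bounded_funE (f : I -> R^o) :
  f \in bounded_fun <-> exists M, forall i, `|f i| <= M.
Proof. by split => [/asboolP|fb]; last exact/asboolP. Qed.

Lemma bounded_fun_submod : GRing.submod_closed bounded_fun.
Proof.
split; first by apply/bounded_funE; exists 0 => i; rewrite normr0.
move=> a f g /bounded_funE[M fM] /bounded_funE[N gN]; apply/bounded_funE.
exists (`|a| * M + N) => i; rewrite (le_trans (ler_normD _ _))// lerD//.
by rewrite normrM ler_wpM2l.
Qed.

HB.instance Definition _ :=
  GRing.isSubmodClosed.Build R _ bounded_fun bounded_fun_submod.

Record linfty :=
  Linfty { linfty_fun :> I -> R^o; _ : linfty_fun \in bounded_fun }.

HB.instance Definition _ := [isSub for linfty_fun].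
HB.instance Definition _ := [Choice of linfty by <:].
HB.instance Definition _ := [SubChoice_isSubLmodule of linfty by <:].

Implicit Types f g : linfty.

Lemma linftyP f g : f =1 g -> f = g.
Proof. by move=> fg; apply/val_inj/funext. Qed.

Lemma linftyD f g i : (f + g) i = f i + g i. Proof. by []. Qed.
Lemma linftyN f i : (- f) i = - f i. Proof. by []. Qed.
Lemma linftyZ (a : R) f i : (a *: f) i = a * f i. Proof. by []. Qed.

(** If [I] is empty, so is the range, and [sup] returns 0: hence the condition [0 <= M] in
    [linfty_norm_le] and the case analyses below. *)
Definition linfty_norm f : R := sup (range (fun i => `|f i|)).

Lemma linfty_norm_ge f i : `|f i| <= linfty_norm f.
Proof.
case: f => f /=; rewrite /linfty_norm /= => /bounded_funE[M fM].
by apply: ub_le_sup; [exists M => _ [j _ <-]|exists i].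
Qed.

Lemma linfty_norm_le f M : 0 <= M -> (forall i, `|f i| <= M) ->
  linfty_norm f <= M.
Proof.
move=> M0 fM; rewrite /linfty_norm.
have [->|/set0P ne] := eqVneq (range (fun i => `|f i|)) set0.
  by rewrite sup0.
by apply: ge_sup => // _ [i _ <-].
Qed.

Lemma linfty_norm_ge0 f : 0 <= linfty_norm f.
Proof.
rewrite /linfty_norm.
have [->|/set0P[_ [i _ _]]] := eqVneq (range (fun i => `|f i|)) set0.
  by rewrite sup0.
exact: le_trans (linfty_norm_ge f i).
Qed.

Lemma linfty_normD f g :
  linfty_norm (f + g) <= linfty_norm f + linfty_norm g.
Proof.
apply: linfty_norm_le => [|i]; first by rewrite addr_ge0 ?linfty_norm_ge0.
apply: (le_trans (ler_normD (f i) (g i))).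
exact: lerD (linfty_norm_ge _ _) (linfty_norm_ge _ _).
Qed.

Lemma linfty_normZ (a : R) f : linfty_norm (a *: f) = `|a| * linfty_norm f.
Proof.
have le_normZ (b : R) g : linfty_norm (b *: g) <= `|b| * linfty_norm g.
  apply: linfty_norm_le => [|i]; first by rewrite mulr_ge0 ?linfty_norm_ge0.
  by rewrite [leLHS]normrM; apply: ler_wpM2l => //; exact: linfty_norm_ge.
have [->|a0] := eqVneq a 0.
  apply/eqP; rewrite normr0 mul0r scale0r eq_le linfty_norm_ge0 andbT.
  by apply: linfty_norm_le => // i; rewrite normr0.
apply/eqP; rewrite eq_le le_normZ/= -ler_pdivlMl ?normr_gt0//.
by rewrite -normfV -[in leLHS](scalerK a0 f) le_normZ.
Qed.

Lemma linfty_norm_eq0 f : linfty_norm f = 0 -> f = 0.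
Proof.
move=> f0; apply: linftyP => i; have := linfty_norm_ge f i.
by rewrite f0 normr_le0 => /eqP.
Qed.

HB.instance Definition _ := @Lmodule_isNormed.Build R linfty
  linfty_norm linfty_normD linfty_normZ linfty_norm_eq0.

Lemma ler_linfty f i : `|f i| <= `|f|.
Proof. exact: linfty_norm_ge. Qed.

Lemma linfty_ler f M : 0 <= M -> (forall i, `|f i| <= M) -> `|f| <= M.
Proof. exact: linfty_norm_le. Qed.

(** Coordinatewise limits exist by completeness of the reals. The Cauchy estimate passes to them
    uniformly in the coordinate, which yields both a bounded limit and convergence in norm. *)
Lemma linfty_complete (F : set_system linfty) :
  ProperFilter F -> cauchy F -> cvg F.
Proof.
move=> FF /cauchy_ballP Fc.
have cauchyF e : 0 < e -> exists f, F [set g | `|f - g| < e].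
  by move=> e0; have /cauchy_ballP/cauchyP/(_ _ e0)[f] := Fc; exists f.
have ev_cvg i : cvg ((fun f : linfty => f i) @ F).
  apply: cauchy_cvg; apply: cauchy_exP => e /cauchyF[f Ff]; exists (f i).
  suff : F [set g : linfty | `|f i - g i| < e] by [].
  by apply: filterS Ff => g; exact: le_lt_trans (ler_linfty (f - g) i).
pose l i : R^o := lim ((fun f : linfty => f i) @ F).
have lE f e i : F [set g | `|f - g| < e] -> `|f i - l i| <= e.
  move=> Ff.
  have : (fun g : linfty => `|f i - g i|) @ F --> `|f i - l i|.
    by apply: cvg_norm; apply: cvgB; [exact: cvg_cst|exact: ev_cvg].
  move=> /cvgr_to_le; apply; apply: filterS Ff => g /ltW.
  exact: le_trans (ler_linfty (f - g) i).
have lb : l \in bounded_fun.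
  have [f Ff] := cauchyF 1 ltr01.
  apply/bounded_funE; exists (`|f| + 1) => i.
  rewrite -lerBlDl (le_trans _ (lE _ _ i Ff))// distrC.
  by rewrite (le_trans _ (lerB_dist _ _))// lerB// ler_linfty.
apply/cvg_ex; exists (Linfty lb : linfty).
apply/cvgrPdist_le => /= e e0.
have e20 : 0 < e / 2 by rewrite divr_gt0.
have [f Ff] := cauchyF _ e20.
apply: filterS (Ff) => g fg; rewrite -(subrKA f) (splitr e).
apply: (le_trans (ler_normD _ _)); apply: lerD; last exact: ltW.
apply: linfty_ler => [|i]; first exact: ltW.
by rewrite [leLHS](distrC (l i) (f i)); exact: lE Ff.
Qed.

HB.instance Definition _ := Uniform_isComplete.Build linfty linfty_complete.

End bounded_functions.

(** * Restrictions of bounded functions and norm-attaining functionals *)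

Section bounded_functions_theory.
Variables (R : realType) (I : Type).
Implicit Types f : linfty R I.

Definition linfty_of (f : I -> R^o) (M : R) (fM : forall i, `|f i| <= M) :
  linfty R I := Linfty (proj2 (bounded_funE f) (ex_intro _ M fM)).

Lemma restrict_le (B : pred I) f i : `|(if B i then f i else 0) : R^o| <= `|f|.
Proof. by case: ifP => // _; rewrite ?ler_linfty// normr0. Qed.

Definition linfty_restrict (B : pred I) f : linfty R I :=
  linfty_of (restrict_le B f).

Lemma linfty_restrict_linear (B : pred I) : linear (linfty_restrict B).
Proof.
move=> a f g; apply: linftyP => i; rewrite linftyD linftyZ /=.
by case: ifP => // _; rewrite mulr0 addr0.
Qed.

Lemma linfty_restrict_norm (B : pred I) f : `|linfty_restrict B f| <= `|f|.
Proof. by apply: linfty_ler => // i; exact: restrict_le. Qed.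

Definition linfty1 : linfty R I :=
  linfty_of (f := fun=> 1) (fun=> lexx _).

(* A functional of norm one attaining its norm at [u] vanishes on the functions
   supported where [u] is bounded away from [1]: such a function, suitably
   scaled, can be added to or subtracted from [u] within the unit ball. *)
Lemma norm_attaining_restrict (phi : {linear linfty R I -> R^o})
    (u : linfty R I) (B : pred I) (e : R) :
  (forall f, `|f| <= 1 -> `|phi f| <= 1) -> phi u = 1 -> 0 < e ->
  (forall i, 0 <= u i <= 1) -> (forall i, B i -> u i <= 1 - e) ->
  forall f, phi (linfty_restrict B f) = 0.
Proof.
move=> phi1 phiu e0 u01 uB f; set r := linfty_restrict B f.
have N0 : 0 < `|f| + 1 by rewrite ltr_wpDl.
(* With this scale [c * |f| <= e]; adding 1 keeps the denominator positive when [f = 0]. *)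
pose c := e / (`|f| + 1); have c0 : 0 < c by rewrite divr_gt0.
have key s : `|s| = c -> s * phi r <= 0.
  move=> sc; have: `|u + s *: r| <= 1.
    apply: linfty_ler => // i; rewrite linftyD linftyZ /r/=.
    have /andP[ui0 ui1] := u01 i.
    case: ifPn => [Bi|_]; last by rewrite mulr0 addr0 ger0_norm.
    rewrite (le_trans (ler_normD _ _))// (ger0_norm ui0) -[leRHS](subrK e).
    apply: lerD; first exact: uB.
    rewrite normrM sc /c mulrAC ler_pdivrMr//.
    apply: ler_wpM2l; first exact: ltW.
    by rewrite (le_trans (ler_linfty f i))// lerDl.
  move=> /phi1; rewrite linearD linearZZ phiu => /(le_trans (ler_norm _)).
  by rewrite gerDl.
apply/eqP; rewrite eq_le -(pmulr_rle0 _ c0) key ?gtr0_norm//=.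
rewrite -oppr_le0 -(pmulr_rle0 _ c0) mulrN -mulNr key//.
by rewrite normrN gtr0_norm.
Qed.

End bounded_functions_theory.

(** Bundles a map built pointwise, once it is proved linear, into a linear map. *)
Lemma linear_functionP (R : realType) (V W : lmodType R) (f : V -> W) :
  linear f -> exists g : {linear V -> W}, g =1 f.
Proof.
move=> fl; pose fL := GRing.isLinear.Build R V W *:%R f fl.
by exists (HB.pack_for {linear V -> W} f fL).
Qed.

(** * The Hahn-Banach theorem through minimal sublinear functionals *)

Section sublinear_functionals.
Variables (R : realType) (V : lmodType R).
Implicit Types (p q : V -> R) (x y z : V).

Definition sublinear p := [/\ p 0 = 0, forall x y, p (x + y) <= p x + p y &
  forall (t : R) x, 0 < t -> p (t *: x) = t * p x].

(* The infima are finite: the sum of [s] in [S x] and [s'] in [S (- x)] lies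
   above an element of [S 0], hence [- s'] bounds [S x] from below. *)
Lemma inf_sublinear (S : V -> set R) :
  (forall x, S x !=set0) -> S 0 0 -> lbound (S 0) 0 ->
  (forall x y s s', S x s -> S y s' -> exists2 r, S (x + y) r & r <= s + s') ->
  (forall t x s, 0 < t -> S x s -> exists2 r, S (t *: x) r & r <= t * s) ->
  sublinear (inf \o S) /\ forall x s, S x s -> inf (S x) <= s.
Proof.
move=> S0 S00 lbS0 SD SZ.
have inf_leS x s : S x s -> inf (S x) <= s.
  apply: ge_inf; have [s' Ss'] := S0 (- x); exists (- s') => r Sr.
  have [u] := SD _ _ _ _ Sr Ss'; rewrite subrr => /lbS0 u0 /(le_trans u0).
  by rewrite -lerBlDr sub0r.
have inf_le x s r : S x r -> r <= s -> inf (S x) <= s.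
  by move=> /inf_leS; exact: le_trans.
have infZ t x : 0 < t -> inf (S (t *: x)) <= t * inf (S x).
  move=> t0; rewrite -ler_pdivrMl//; apply: lb_le_inf => // s Ss.
  rewrite ler_pdivrMl//; have [r Sr rs] := SZ _ _ _ t0 Ss.
  exact: inf_le Sr rs.
split=> //; split=> /=.
- apply/eqP; rewrite eq_le inf_leS//=; exact: (lb_le_inf (S0 0)).
- move=> x y; rewrite -lerBlDr; apply: lb_le_inf => // s Ss.
  rewrite lerBlDr -lerBlDl; apply: lb_le_inf => // s' Ss'.
  rewrite lerBlDl; have [r Sr rs] := SD _ _ _ _ Ss Ss'.
  exact: inf_le Sr rs.
- move=> t x t0; apply/eqP; rewrite eq_le infZ//= -ler_pdivlMl//.
  by rewrite -[in leLHS](scalerK (lt0r_neq0 t0) x) infZ// invr_gt0.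
Qed.

(* Minimality is tested against [y |-> inf_(t >= 0) (p (y + t *: z) - t * p z)],
   which is sublinear, at most [p y] and at most [p (y + z) - p z]. *)
Lemma minimal_sublinear_linear p : sublinear p ->
  (forall q, sublinear q -> (forall x, q x <= p x) -> forall x, p x <= q x) ->
  linear (p : V -> R^o).
Proof.
move=> [p0 pD pZ] pmin.
have pZ0 (t : R) x : 0 <= t -> p (t *: x) = t * p x.
  by rewrite le_eqVlt => /predU1P[<-|/pZ//]; rewrite scale0r mul0r.
have pDE x z : p (x + z) = p x + p z.
  apply/eqP; rewrite eq_le pD/= -lerBrDr.
  pose S y := [set p (y + t *: z) - t * p z | t in [set t : R | 0 <= t]].
  have [||||t y _ t0 [u /= u0 <-]|qs q_le] := @inf_sublinear S.
  - by move=> y; exists (p (y + 0 *: z) - 0 * p z); exists 0 => /=.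
  - by exists 0 => //=; rewrite scale0r mul0r addr0 p0 subr0.
  - by move=> _ [t /= t0 <-]; rewrite add0r pZ0// subrr.
  - move=> y y' _ _ [t /= t0 <-] [t' /= t'0 <-].
    exists (p (y + y' + (t + t') *: z) - (t + t') * p z).
      by exists (t + t') => //=; rewrite addr_ge0.
    by rewrite scalerDl addrACA mulrDl opprD [leRHS]addrACA lerD2r.
  - exists (p (t *: y + (t * u) *: z) - (t * u) * p z).
      by exists (t * u) => //=; rewrite mulr_ge0// ltW.
    by rewrite -scalerA -scalerDr pZ// -mulrA -mulrBr.
  apply: (le_trans (pmin _ qs _ x)) => [y|].
    by apply: q_le; exists 0 => //=; rewrite scale0r mul0r addr0 subr0.
  by apply: q_le; exists 1 => //=; rewrite scale1r mul1r.
have pN x : p (- x) = - p x.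
  by apply/eqP; rewrite -subr_eq0 opprK -pDE addNr p0 eqxx.
move=> a x y; rewrite pDE; congr (_ + _).
have [a0|a0] := leP 0 a; first exact: pZ0.
by rewrite -[in LHS](opprK a) scaleNr pN pZ ?oppr_gt0// mulNr opprK.
Qed.

(** Zorn's lemma provides a minimal sublinear functional below [q], which is linear; a nonempty
    chain is bounded below by its pointwise infimum. *)
Lemma sublinear_dominates_linear q : sublinear q ->
  exists g : {linear V -> R^o}, forall x, g x <= q x.
Proof.
move=> qs; pose T := {p | sublinear p /\ forall x, p x <= q x}.
pose q0 : T := exist _ q (conj qs (fun=> lexx _)).
(* The order is reversed: maximal elements for [le] are minimal functionals. *)
pose le (p r : T) := `[<forall x, sval r x <= sval p x>].
have [||C Cchain|[p [ps pq]] pmin] := @ZL_preorder T q0 le.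
- by move=> p; apply/asboolP.
- move=> r p s /asboolP rp /asboolP ps; apply/asboolP => x.
  exact: le_trans (rp x).
- have [[c Cc]|C0] := pselect (C !=set0); last first.
    by exists q0 => s Cs; case: C0; exists s.
  pose S x := [set sval p x | p in C].
  have [|||||ms m_le] := @inf_sublinear S.
  + by move=> x; exists (sval c x); exists c.
  + by exists c => //; have [[]] := svalP c.
  + by move=> _ [p Cp <-]; have [[->]] := svalP p.
  + move=> x y _ _ [p Cp <-] [r Cr <-].
    have [/asboolP pr|/asboolP rp] := Cchain p r Cp Cr.
      exists (sval r (x + y)); first by exists r.
      by have [[_ rD _] _] := svalP r; rewrite (le_trans (rD _ _))// lerD.
    exists (sval p (x + y)); first by exists p.
    by have [[_ pD _] _] := svalP p; rewrite (le_trans (pD _ _))// lerD.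
  + move=> t x _ t0 [p Cp <-]; exists (sval p (t *: x)); first by exists p.
    by have [[_ _ ->]] := svalP p.
  have mq x : inf (S x) <= q x.
    by apply: le_trans (proj2 (svalP c) x); apply: m_le; exists c.
  exists (exist _ (inf \o S) (conj ms mq) : T) => p Cp; apply/asboolP => x /=.
  by apply: m_le; exists p.
have /linear_functionP[g gp] : linear (p : V -> R^o).
  apply: minimal_sublinear_linear => // r rs rp.
  have rq x : r x <= q x by exact: le_trans (rp x) (pq x).
  suff /asboolP : le (exist _ r (conj rs rq)) (exist _ p (conj ps pq)) by [].
  by apply: pmin; apply/asboolP.
by exists g => x; rewrite gp.
Qed.

End sublinear_functionals.

(* No subspace is needed: a linear functional below the sublinear
   [y |-> inf_w (f w + `|y - i w|)] is automatically an extension of [f]. *)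
Lemma hahn_banach (R : realType) (W : lmodType R) (Y : normedModType R)
    (i : {linear W -> Y}) (f : {linear W -> R^o}) :
  (forall w, f w <= `|i w|) ->
  exists2 g : {linear Y -> R^o}, forall w, g (i w) = f w &
    forall y, `|g y| <= `|y|.
Proof.
move=> fi; pose S y := [set f w + `|y - i w| | w in [set: W]].
have S1 w y : S y (f w + `|y - i w|) by exists w.
have [||||t y _ t0 [w _ <-]|qs q_le] := @inf_sublinear R Y S.
- by move=> y; exists (f 0 + `|y - i 0|).
- by exists 0 => //; rewrite (linear0 f) (linear0 i) subr0 normr0 addr0.
- move=> _ [w _ <-]; rewrite sub0r normrN -lerBlDl sub0r.
  by rewrite -(linearN f) -normrN -(linearN i).
- move=> x y _ _ [w _ <-] [w' _ <-].
  exists (f (w + w') + `|x + y - i (w + w')|) => //.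
  rewrite (linearD f) (linearD i) opprD [in leLHS](addrACA x).
  by rewrite [leRHS]addrACA lerD2l ler_normD.
- exists (f (t *: w) + `|t *: y - i (t *: w)|) => //.
  rewrite (linearZZ f) (linearZZ i) -scalerBr normrZ gtr0_norm// [leRHS]mulrDr.
  exact: lexx.
have [g gq] := sublinear_dominates_linear qs.
have gi w : g (i w) <= f w.
  apply: (le_trans (gq _)); apply: q_le; exists w => //.
  by rewrite subrr normr0 addr0.
have g1 y : g y <= `|y|.
  apply: (le_trans (gq _)); apply: q_le; exists 0 => //.
  by rewrite (linear0 f) (linear0 i) subr0 add0r.
exists g => [w|y].
  apply/eqP; rewrite eq_le gi/= -[f w]opprK -(linearN f) lerNl.
  by rewrite (le_trans _ (gi _))// (linearN i) (linearN g).
by rewrite ler_norml g1 andbT lerNl -(linearN g) (le_trans (g1 _))// normrN.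
Qed.

(** Hahn-Banach applied to the functional sending [t *: x] to [t * |x|], parametrized by the real
    line. *)
Lemma norming_functional (R : realType) (X : normedModType R) (x : X) :
  exists2 g : {linear X -> R^o}, g x = `|x| & forall y, `|g y| <= `|y|.
Proof.
have /linear_functionP[i iE] : linear (fun t : R^o => t *: x).
  by move=> a s t; rewrite scalerDl scalerA.
have /linear_functionP[f fE] : linear (fun t : R^o => t * `|x| : R^o).
  by move=> a s t; rewrite mulrDl -scalerAl.
have [|g gi g1] := @hahn_banach R R^o X i f.
  by move=> t; rewrite fE iE normrZ ler_wpM2r// ler_norm.
by exists g => //; rewrite -[x in LHS]scale1r -(iE 1) gi fE mul1r.
Qed.

Lemma linear_ler_continuous (R : realType) (V W : normedModType R)
    (f : {linear V -> W}) (C : R) :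
  (forall x, `|f x| <= C * `|x|) -> continuous f.
Proof.
move=> fC; apply/bounded_linear_continuous/bounded_funP => r.
exists (`|C| * r) => x xr; apply: (le_trans (fC x)).
by apply: (le_trans (ler_wpM2r _ (ler_norm C))) => //; exact: ler_wpM2l.
Qed.

Lemma linear_unit_ball_bound (R : realType) (V W : normedModType R)
    (f : {linear V -> W}) (C : R) :
  (forall x, `|x| <= 1 -> `|f x| <= C) -> forall x, `|f x| <= C * `|x|.
Proof.
move=> fC x; have [->|x0] := eqVneq x 0.
  by rewrite linear0 !normr0 mulr0.
have nx0 : 0 < `|x| by rewrite normr_gt0.
rewrite -ler_pdivrMr// mulrC -[X in X * _]gtr0_norm ?invr_gt0// -normrZ.
rewrite -linearZZ; apply: fC.
by rewrite normrZ gtr0_norm ?invr_gt0// mulVf// gt_eqF.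
Qed.

(** * Compactness of closed balls in finite dimension *)

Section finite_dimension.
Import VectorInternalTheory.
Variables (R : realType) (X : normedVectType R).

Lemma r2v_continuous : continuous (r2v : 'rV[R]_(dim X) -> X).
Proof.
apply: (@linear_ler_continuous _ _ _ _
  (\sum_(j < dim X) `|(r2v (delta_mx 0 j) : X)|)) => u.
rewrite [u in leLHS]row_sum_delta linear_sum mulr_suml.
apply: (le_trans (ler_norm_sum _ _ _)); apply: ler_sum => j _.
rewrite linearZZ normrZ mulrC ler_wpM2l//.
rewrite [leRHS]/Num.norm/= mx_normrE; apply/bigmax_geP; right.
by exists (ord0, j).
Qed.

(** The constant is the minimum of the norm of [X] over the compact unit sphere of the coordinate
    space, positive because [r2v] is injective. *)
Lemma r2v_norm_ge : exists2 m : R, 0 < m &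
  forall u : 'rV[R]_(dim X), m * `|u| <= `|(r2v u : X)|.
Proof.
pose K := [set u : 'rV[R]_(dim X) | `|u| = 1].
have Kn u : u != 0 -> K (`|u|^-1 *: u).
  by move=> u0; rewrite /K/= normrZ normfV normr_id mulVf// normr_eq0.
have cN : continuous (fun u : 'rV[R]_(dim X) => `|(r2v u : X)|).
  move=> u.
  exact: (continuous_comp (@r2v_continuous u) (@norm_continuous _ _ _)).
(* If the sphere is empty, the only vector is 0 and any constant works. *)
have [K0|K0] := pselect (K !=set0); last first.
  exists 1 => // u; have [->|/Kn Ku] := eqVneq u 0.
    by rewrite linear0 !normr0 mulr0.
  by case: K0; eexists; exact: Ku.
have cK : compact K.
  apply: bounded_closed_compact.
    by exists 1; split => // x x1 u; rewrite /K/= => ->; exact: ltW.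
  apply: (closed_comp (f := fun u : 'rV[R]_(dim X) => `|u|) (D := [set 1])).
    by move=> u _; exact: norm_continuous.
  exact: closed_eq.
have [c /set_mem Kc cmin] := compact_EVT_min K0 cK (continuous_subspaceT cN).
exists `|(r2v c : X)| => [|u].
  rewrite normr_gt0; apply/eqP => /(congr1 v2r); rewrite r2vK linear0 => c0.
  by move: Kc; rewrite /K/= c0 normr0 => /esym/eqP; rewrite oner_eq0.
have [->|u0] := eqVneq u 0; first by rewrite linear0 !normr0 mulr0.
rewrite -ler_pdivlMr ?normr_gt0// mulrC.
by have := cmin _ (mem_set (Kn _ u0)); rewrite linearZZ normrZ normfV normr_id.
Qed.

Lemma compact_norm_le (r : R) : compact [set x : X | `|x| <= r].
Proof.
have [m m0 mP] := r2v_norm_ge.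
have cN : continuous (fun u : 'rV[R]_(dim X) => `|(r2v u : X)|).
  move=> u.
  exact: (continuous_comp (@r2v_continuous u) (@norm_continuous _ _ _)).
rewrite (_ : [set _ | _] =
    r2v @` [set u : 'rV[R]_(dim X) | `|(r2v u : X)| <= r]); last first.
  apply/seteqP; split=> [x xr|_ [u /= ur <-]//].
  by exists (v2r x) => /=; rewrite v2rK.
apply: continuous_compact; first exact/continuous_subspaceT/r2v_continuous.
apply: bounded_closed_compact.
  exists (m^-1 * r); split; first exact: num_real.
  move=> x xr u /= ur; apply: le_trans (ltW xr).
  by rewrite -ler_pdivrMl ?invr_gt0// invrK (le_trans (mP u)).
apply: (closed_comp (f := fun u : 'rV[R]_(dim X) => `|(r2v u : X)|)
  (D := [set x | x <= r])); first by move=> u _; exact: cN.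
exact: closed_le.
Qed.

End finite_dimension.

(** * Limits of sequences of points and of linear maps along an ultrafilter *)

Lemma ultra_cvg_compact (T : topologicalType) (U : set_system nat)
    (K : set T) (u : nat -> T) :
  UltraFilter U -> compact K -> (forall k, K (u k)) ->
  exists2 l, K l & u @ U --> l.
Proof.
move=> UU cK Ku; have FU : ProperFilter U by exact: ultra_proper.
have FP : ProperFilter (u @ U) by exact: fmap_proper_filter.
have uUU : UltraFilter (u @ U).
  split=> // G GP sUG; apply/seteqP; split=> // A GA.
  have [//|UA] := in_ultra_setVsetC (u @^-1` A) UU.
  have GnA : G (~` A) by exact: sUG.
  by have [x []] := filter_ex (filterI GA GnA).
have : U (u @^-1` K) by exact: filterE.
move: cK; rewrite compact_ultra => /(_ _ uUU) /[apply] -[l [Kl ul]].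
by exists l.
Qed.

(** Pointwise limits exist by compactness, and uniqueness of limits makes them linear in [v]. *)
Lemma ultra_limit_linear (R : realType) (V : lmodType R) (W : normedModType R)
    (U : set_system nat) (F : nat -> V -> W) :
  UltraFilter U -> (forall k, linear (F k)) ->
  (forall v, exists2 K : set W, compact K & forall k, K (F k v)) ->
  exists L : {linear V -> W}, forall v, F ^~ v @ U --> L v.
Proof.
move=> UU Fl FK; have FU : ProperFilter U by exact: ultra_proper.
have [L LP] : {L : V -> W & forall v, F ^~ v @ U --> L v}.
  apply: (@choice V W (fun v l => F ^~ v @ U --> l)) => v.
  have [K cK FvK] := FK v.
  by have [l _ Fl'] := ultra_cvg_compact UU cK FvK; exists l.
have /linear_functionP[g gL] : linear L.
  move=> a x y.
  apply: (@cvg_unique _ (@norm_hausdorff _ W) (F ^~ (a *: x + y) @ U)).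
    exact: LP.
  rewrite (_ : F ^~ _ = fun k => a *: F k x + F k y); last first.
    by apply/funext => k; rewrite Fl.
  by apply: cvgD; [apply: cvgZr|]; exact: LP.
by exists g => v; rewrite gL.
Qed.

(** * Supporting functionals and smoothness *)

Section supporting.
Variables (R : realType) (X : normedModType R).

Lemma supporting_functional_ler (x : X) (h : {linear X -> R^o}) :
  supporting_functional x h -> forall y, `|h y| <= `|y|.
Proof.
move=> [[/linear_bounded_continuous/linear_boundedP hb h1] _].
have [r [_ hr]] := hb.
have {}hr y : `|h y| <= (r + 1) * `|y| by apply: hr; rewrite ltrDl.
move=> y; rewrite -[leRHS]mul1r; apply: linear_unit_ball_bound => {}y y1.
(* The bound given by continuity makes the set in [dual_norm] bounded, so that [sup] is a true
   supremum. *)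
rewrite -h1; apply: ub_le_sup; last by exists y.
exists `|r + 1| => _ [z z1 <-]; apply: (le_trans (hr z)).
apply: (le_trans (ler_wpM2r _ (ler_norm _))) => //.
by rewrite ler_piMr.
Qed.

Lemma supporting_functionalP (x : X) (g : {linear X -> R^o}) :
  unit_sphere x -> (forall y, `|g y| <= `|y|) -> g x = 1 ->
  supporting_functional x g.
Proof.
move=> x1 g1 gx; split=> //; split.
  by apply: (@linear_ler_continuous _ _ _ _ 1) => y; rewrite mul1r.
apply/eqP; rewrite eq_le; apply/andP; split.
  apply: ge_sup; first by exists `|g 0|, 0 => //; rewrite /unit_ball/= normr0.
  by move=> _ [y y1 <-]; exact: le_trans (g1 y) y1.
apply: ub_le_sup; first by exists 1 => _ [y y1 <-]; exact: le_trans (g1 y) y1.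
by exists x; rewrite ?gx ?normr1// /unit_ball/= x1.
Qed.

(** Otherwise some [G N] in each cap stays farther than [e] from [h] at [x]. Their limit along an
    ultrafilter supports the ball at [x1], so it is [h] by smoothness, a contradiction. *)
Lemma smooth_cap (x1 : X) (h : {linear X -> R^o}) :
  smooth_point x1 -> supporting_functional x1 h ->
  forall x e, 0 < e -> exists N, forall k (g : {linear X -> R^o}), (N <= k)%N ->
    (forall y, `|g y| <= `|y|) -> 1 - k.+1%:R^-1 < g x1 -> `|g x - h x| <= e.
Proof.
move=> [x1n [h0 _ h0u]] hs x e e0; apply: contrapT => noN.
have /choice[G GP] : forall N, exists g : {linear X -> R^o},
    [/\ forall y, `|g y| <= `|y|, 1 - N.+1%:R^-1 < g x1 & e < `|g x - h x|].
  move=> N; apply: contrapT => nog; apply: noN; exists N => k g Nk g1 gx1.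
  rewrite leNgt; apply/negP => gx; apply: nog; exists g; split=> //.
  (* The caps decrease: a [g] in the cap of index [k >= N] lies in that of index [N]. *)
  apply: le_lt_trans gx1; rewrite lerD2l lerN2 lef_pV2 ?posrE//.
  by rewrite ler_nat.
have [U [UU oU]] := @ultraFilterLemma _ \oo _.
have FU : ProperFilter U by exact: ultra_proper.
have [||L LP] := @ultra_limit_linear R X R^o U (fun k => G k : X -> R^o) UU.
- by move=> k a y z; rewrite linearP.
- move=> y; exists `[- `|y|, `|y|]%classic; first exact: segment_compact.
  by move=> k /=; rewrite in_itv/= -ler_norml; have [] := GP k.
have L1 y : `|L y| <= `|y|.
  have /cvgr_to_le : (fun k => `|G k y|) @ U --> `|L y| by exact: cvg_norm.
  by apply; apply: filterE => k; have [] := GP k.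
have Lx1 : L x1 = 1.
  apply/eqP; rewrite eq_le (le_trans (ler_norm _))//=; last first.
    by rewrite (le_trans (L1 x1)) ?x1n.
  have : (fun k => G k x1 + k.+1%:R^-1) @ U --> L x1 + 0.
    apply: cvgD; first exact: LP.
    exact: cvg_trans (cvg_app _ oU) (@cvg_harmonic R).
  rewrite addr0 => /cvgr_to_ge; apply; apply: filterE => k.
  by rewrite -lerBlDr ltW//; have [] := GP k.
have Lh : L x = h x.
  by rewrite (h0u _ (supporting_functionalP x1n L1 Lx1)) (h0u _ hs).
have : (fun k => `|G k x - h x|) @ U --> `|L x - h x|.
  by apply: cvg_norm; apply: cvgB; [exact: LP|exact: cvg_cst].
rewrite Lh subrr normr0 => /cvgr_to_ge ge0.
suff : e <= 0 by rewrite leNgt e0.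
by apply: ge0; apply: filterE => k; rewrite ltW//; have [] := GP k.
Qed.

End supporting.

(** * The isometric embedding by evaluation and its norm-one extensions *)

Section canonical_embedding.
Variables (R : realType) (X : normedModType R) (x1 : X).

(* Half of the dual ball suffices to norm [X], and keeps the coordinates close
   to [- h] away: all the coordinates of the image of [x1] are in [0, 1]. *)
Definition half_dual_ball :=
  {g : {linear X -> R^o} | (forall x, `|g x| <= `|x|) /\ 0 <= g x1}.

Definition canonical_embedding (x : X) : linfty R half_dual_ball :=
  linfty_of (f := fun g : half_dual_ball => sval g x)
    (fun g => proj1 (svalP g) x).

Local Notation E := canonical_embedding.

Lemma canonical_embedding_linear : linear E.
Proof.
by move=> a x y; apply: linftyP => g; rewrite linftyD linftyZ /= linearP.
Qed.

(** Either a norming functional of [x] or its opposite is nonnegative at [x1], hence is a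
    coordinate. *)
Lemma canonical_embedding_norm x : `|E x| = `|x|.
Proof.
apply/eqP; rewrite eq_le; apply/andP; split.
  by apply: linfty_ler => // g; exact: (proj1 (svalP g)).
have [g gx g1] := norming_functional x.
have [gx1|gx1] := leP 0 (g x1).
  have := ler_linfty (E x) (exist _ g (conj g1 gx1)).
  by rewrite /= gx normr_id.
have /linear_functionP[g' g'E] : linear (fun y => - g y : R^o).
  by move=> a y z; rewrite linearP opprD scalerN.
have g'1 y : `|g' y| <= `|y| by rewrite g'E normrN.
have g'x1 : 0 <= g' x1 by rewrite g'E oppr_ge0 ltW.
have := ler_linfty (E x) (exist _ g' (conj g'1 g'x1)).
by rewrite /= g'E normrN gx normr_id.
Qed.

Lemma canonical_embedding_extends (Y : normedModType R) (i : {linear X -> Y}) :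
  (forall x, `|i x| = `|x|) ->
  exists T : {linear Y -> linfty R half_dual_ball},
    (forall x, T (i x) = E x) /\ forall y, `|T y| <= `|y|.
Proof.
move=> i_iso.
have exG (g : half_dual_ball) : exists G : {linear Y -> R^o},
    (forall x, G (i x) = sval g x) /\ forall y, `|G y| <= `|y|.
  have [x|G GE G1] := @hahn_banach R X Y i (sval g).
    by rewrite i_iso (le_trans (ler_norm _))// (proj1 (svalP g)).
  by exists G.
have [G GP] := choice exG.
pose T y := linfty_of (f := G ^~ y) (fun g => proj2 (GP g) y).
have /linear_functionP[T' T'E] : linear T.
  by move=> a y z; apply: linftyP => g; rewrite linftyD linftyZ /= linearP.
exists T'; split => [x|y]; rewrite T'E.
  by apply: linftyP => g /=; rewrite (proj1 (GP g)).
by apply: linfty_ler => // g /=; rewrite (proj2 (GP g)).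
Qed.

End canonical_embedding.

(** * A projection sending the unit ball into a prism inside [A] *)

Section prism_projection.
Variables (R : realType) (X : normedVectType R) (x1 : X).
Variable h : {linear X -> R^o}.
Hypotheses (x1_smooth : smooth_point x1) (hx1 : supporting_functional x1 h).
Variable A : set X.
Hypotheses (A_bounded : bounded_set A) (A_closed : closed A).
Hypothesis A_slab : A `<=` [set x | `|h x| <= 1].
Local Notation Y := (linfty R (half_dual_ball x1)).
Local Notation E := (@canonical_embedding R X x1).
Variable P : {linear Y -> X}.
Hypotheses (PE : forall x, P (E x) = x) (PA : forall f, `|f| <= 1 -> A (P f)).

(* [cut k] discards the coordinates of the cap [1 - 1/(k+1) < g x1]. In the
   limit, [P] is replaced by a projection that reads the mass of the shrinking
   caps at the single coordinate [h]. *)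
Lemma prism_projection : exists (p : X) (S : {linear Y -> X}),
  [/\ h p = 1, forall x, S (E x) = x, forall f, `|f| <= 1 -> `|h (S f)| <= 1 &
    forall f t, `|f| <= 1 -> `|t| <= 1 -> A (S f - h (S f) *: p + t *: p)].
Proof.
have h1 := supporting_functional_ler hx1.
have [[h_cont _] hx1E] := hx1.
have x1n : `|x1| = 1 by case: x1_smooth.
have h_half : (forall x, `|h x| <= `|x|) /\ 0 <= h x1.
  by split=> //; rewrite hx1E.
pose h' : half_dual_ball x1 := exist _ (h : {linear X -> R^o}) h_half.
have [C PC] : exists C, forall f, `|P f| <= C * `|f|.
  have [M [_ AM]] := A_bounded; exists (M + 1).
  by apply: linear_unit_ball_bound => f /PA; apply: AM; rewrite ltrDl.
pose B k : pred (half_dual_ball x1) := fun g => sval g x1 <= 1 - k.+1%:R^-1.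
pose cut k := @linfty_restrict R _ (B k).
have hPcut k f : h (P (cut k f)) = 0.
  have /linear_functionP[phi phiE] : linear (fun f => h (P f) : R^o).
    by move=> a u v; rewrite !linearP.
  rewrite -phiE.
  (* The slab condition bounds [h P] by 1 on the unit ball, and it equals 1 at [E x1], whose
     coordinates in [B k] are at most [1 - 1/(k+1)]. *)
  apply: (@norm_attaining_restrict _ _ _ (E x1) _ k.+1%:R^-1) => //.
  - by move=> u u1; rewrite phiE; apply/A_slab/PA.
  - by rewrite phiE PE.
  - move=> g /=; rewrite (proj2 (svalP g)) (le_trans (ler_norm _))//.
    by rewrite (le_trans (proj1 (svalP g) x1)) ?x1n.
have [U [UU oU]] := @ultraFilterLemma _ \oo _.
have FU : ProperFilter U by exact: ultra_proper.
have [||L LP] := @ultra_limit_linear R Y X U (fun k f => P (cut k f)) UU.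
- by move=> k a u v; rewrite /cut linfty_restrict_linear linearP.
- move=> f; exists [set x : X | `|x| <= `|C| * `|f|].
    exact: compact_norm_le.
  move=> k /=; apply: (le_trans (PC _)).
  apply: (le_trans (ler_wpM2r _ (ler_norm C))) => //.
  by apply: ler_wpM2l => //; exact: linfty_restrict_norm.
pose one : Y := linfty1 R _.
pose p := P one - L one.
(* [one - cut k one] is the indicator of the cap. *)
have pP : (fun k => P (one - cut k one)) @ U --> p.
  rewrite (_ : (fun k => _) = fun k => P one - P (cut k one)).
    by apply: cvgB; [exact: cvg_cst|exact: LP].
  by apply/funext => k; rewrite linearB.
have hL f : h (L f) = 0.
  apply: (@cvg_unique _ (@norm_hausdorff _ R^o)
    ((h \o (fun k => P (cut k f))) @ U)).
    by apply: continuous_cvg; [exact: h_cont|exact: LP].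
  rewrite (_ : _ \o _ = fun=> 0); first exact: cvg_cst.
  by apply/funext => k; exact: hPcut.
have /linear_functionP[S SE] : linear (fun f => L f + f h' *: p).
  move=> a f g; rewrite (linearP L) [in LHS](scalerDl p (a * f h') (g h')).
  by rewrite -scalerA addrACA -scalerDr.
have SEx x : S (E x) = x.
  rewrite SE; apply: (@cvg_unique _ (@norm_hausdorff _ X)
    ((fun k => P (cut k (E x)) + h x *: P (one - cut k one)) @ U)).
    by apply: cvgD; [exact: LP|exact: cvgZr].
  apply/cvgrPdist_le => e e0.
  have C0 : 0 < `|C| + 1 by rewrite ltr_wpDl.
  have e'0 : 0 < e / (`|C| + 1) by rewrite divr_gt0.
  have [N NP] := smooth_cap x1_smooth hx1 x e'0.
  apply: oU; exists N => // k /= Nk.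
  (* The difference is [P] of a function that is 0 on [B k] and [g x - h x] on the cap, small by
     [smooth_cap]. *)
  rewrite -[X in X - _]PE -linearZZ -linearD -linearB.
  apply: (le_trans (PC _)).
  have CC : C <= `|C| + 1 by rewrite (le_trans (ler_norm _))// lerDl.
  apply: (le_trans (ler_wpM2r _ CC)) => //; rewrite mulrC -ler_pdivlMr//.
  apply: linfty_ler => [|g]; first exact: ltW.
  rewrite !(linftyD, linftyN, linftyZ) /= opprD.
  have [Bg|Bg] := boolP (B k g).
    by rewrite subrr mulr0 subr0 subrr normr0 ltW.
  rewrite oppr0 add0r addr0 mulr1; apply: (NP k (sval g)) => //.
    exact: (proj1 (svalP g)).
  by rewrite ltNge.
have hSp f : h (S f) = f h' * h p.
  by rewrite SE (linearD h) hL add0r (linearZZ h).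
have hp : h p = 1.
  (* At [E x1] both [h (S (E x1))] and the coordinate [h'] equal [h x1 = 1]. *)
  by have := hSp (E x1); rewrite SEx [E x1 h']hx1E hx1E mul1r.
have hS f : h (S f) = f h' by rewrite hSp hp mulr1.
exists p, S; split=> [//|//|f f1|f t f1 t1].
  by rewrite hS (le_trans (ler_linfty f _)).
rewrite hS SE addrK.
(* The approximants are values of [P] at functions equal to [f] on [B k] and to [t] on the cap,
   hence in the unit ball. *)
apply: (@closed_cvg _ _ U _
  (fun k => P (cut k f) + t *: P (one - cut k one))) => //.
  apply: filterE => k; rewrite -linearZZ -linearD; apply: PA.
  apply: linfty_ler => // g; rewrite !(linftyD, linftyN, linftyZ) /=.
  case: ifP => _; last by rewrite add0r subr0 mulr1.
  by rewrite subrr mulr0 addr0 (le_trans (ler_linfty f g)).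
by apply: cvgD; [exact: LP|exact: cvgZr].
Qed.

End prism_projection.

(** * The largest prism in [A] with axis [p], and its ball properties *)

Section maximal_prism.
Variables (R : realType) (X : normedVectType R) (h : {linear X -> R^o}) (p : X).
Variable A : set X.
Hypothesis hp : h p = 1.

(* The largest basis in the kernel of [h] giving a prism contained in [A]. *)
Definition prism_basis : set X :=
  [set d | h d = 0 /\ forall t, `|t| <= 1 -> A (d + t *: p)].

(** Stated through the projection [x - h x *: p] onto the kernel of [h], so that closedness,
    convexity and symmetry come from those of [A]. *)
Definition maximal_prism : set X :=
  [set x | `|h x| <= 1 /\ forall t, `|t| <= 1 -> A (x - h x *: p + t *: p)].

Lemma maximal_prism_sub : maximal_prism `<=` A.
Proof. by move=> x [hx1 /(_ _ hx1)]; rewrite subrK. Qed.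

Lemma maximal_prismE : maximal_prism =
  [set d + s | d in prism_basis & s in line_segment (- p) p].
Proof.
have hB x : h (x - h x *: p) = 0.
  by rewrite linearB linearZZ hp [_ *: _]mulr1 subrr.
apply/seteqP; split=> [x [hx1 xA]|_ [d [hd dA] [_ [s s01 <-]] <-]].
  exists (x - h x *: p); first by split=> //; exact: hB.
  exists (h x *: p); last by rewrite subrK.
  (* The point of parameter [s] on the segment is [(2 s - 1) *: p]. *)
  exists ((h x + 1) / 2).
    by move: hx1; rewrite /= in_itv/= ler_norml => /andP[? ?]; apply/andP; lra.
  rewrite scalerN -scaleNr -scalerDl; congr (_ *: _); lra.
rewrite scalerN -scaleNr -scalerDl; set r := _ + s.
have r1 : `|r| <= 1.
  by move: s01; rewrite /r/= in_itv/= ler_norml => /andP[? ?]; apply/andP; lra.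
have hr : h (d + r *: p) = r by rewrite linearD hd add0r linearZZ hp [LHS]mulr1.
by split; rewrite hr// addrK.
Qed.

Lemma maximal_prism_symmetric : symmetric_set A -> symmetric_set maximal_prism.
Proof.
move=> As x [hx1 xA]; split; first by rewrite linearN normrN.
move=> t t1; rewrite linearN scaleNr -opprD -[t]opprK scaleNr -opprD.
by apply/As/xA; rewrite normrN.
Qed.

Lemma maximal_prism_convex : convex_set A -> convex_set maximal_prism.
Proof.
move=> Ac x y l /set_mem[hx xA] /set_mem[hy yA]; apply/mem_set.
have l0 : 0 <= l%:num by [].
have l1 : 0 <= 1 - l%:num by rewrite subr_ge0.
suff : maximal_prism (l%:num *: (x : X) + (1 - l%:num) *: (y : X)) by [].
split=> [|t t1].
  rewrite linearD !linearZZ (le_trans (ler_normD _ _))//.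
  rewrite [X in X + _ <= _]normrM [X in _ + X <= _]normrM.
  rewrite (ger0_norm l0) (ger0_norm l1) -[leRHS](subrK l%:num) addrC.
  by rewrite lerD// ler_piMr.
have /set_mem := Ac _ _ l (mem_set (xA t t1)) (mem_set (yA t t1)).
set z := conv _ _ _; rewrite (_ : z = l%:num *: (x - h x *: p + t *: p) +
  (1 - l%:num) *: (y - h y *: p + t *: p))//; congr A.
(* Linearity of the projection lets it commute with the convex combination; the weights of [t *: p]
   add up to 1. *)
have [q qE] : exists q : {linear X -> X}, forall z, q z = z - h z *: p.
  apply: linear_functionP => a u v.
  rewrite (linearP h) [X in _ - X](scalerDl p (a * h u) (h v)) -scalerA opprD.
  by rewrite addrACA -scalerBr.
rewrite -!qE linearP linearZZ !scalerDr addrACA -scalerDl.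
by rewrite [l%:num + _]addrC subrK scale1r.
Qed.

Lemma maximal_prism_closed : continuous h -> closed A -> closed maximal_prism.
Proof.
move=> hc Ac.
rewrite (_ : maximal_prism = (fun x => `|h x|) @^-1` [set r | r <= 1] `&`
    \bigcap_(t in [set t : R | `|t| <= 1])
      (fun x => x - h x *: p + t *: p) @^-1` A) //.
apply: closedI.
  apply: preimage_closed; last exact: closed_le.
  by move=> x _; apply: cvg_norm; exact: hc.
apply: closed_bigI => t _; apply: preimage_closed => // x _.
apply: cvgD; last exact: cvg_cst.
by apply: cvgB; [exact: cvg_id|apply: cvgZl; exact: hc].
Qed.

End maximal_prism.

(** * The maximal prism as a sufficient enlargement *)

Theorem theorem3 (R : realType) (n : nat) (X : normedVectType R)
    (dimX : \dim {:X} = n)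
    (x1 : X) (x1_smooth : smooth_point x1)
    (h : {linear X -> R^o}) (h_x1 : supporting_functional x1 h)
    (xs : n.-1.-tuple X)
    (xs_sphere : forall i, unit_sphere (tnth xs i))
    (x_basis : basis_of {:X} (x1 :: xs))
    (h_xs : forall i, h (tnth xs i) = 0)
    (A : set X) (A_suff : sufficient_enlargement A)
    (A_slab : A `<=` [set x | `|h x| <= 1]) :
  exists D M : set X,
    [/\ prism_with_basis D M, symmetric_set M, parallel_to D <<xs>>%VS,
        M `<=` A & sufficient_enlargement M].
Proof.
have [[Ab Ac Aconv _ Asym] Aproj] := A_suff.
have [E EE] := linear_functionP (canonical_embedding_linear x1).
have [P [_ PE PA]] : exists P : {linear linfty R (half_dual_ball x1) -> X},
    [/\ continuous P, forall x, P (E x) = x & P @` (@unit_ball R _) `<=` A].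
  by apply: Aproj => x; rewrite EE canonical_embedding_norm.
have [||p [S [hp SE hS SA]]] :=
    prism_projection x1_smooth h_x1 Ab Ac A_slab (P := P).
- by move=> x; rewrite -EE.
- by move=> f f1; apply: PA; exists f.
set D := prism_basis h p A; set M := maximal_prism h p A.
have SM f : `|f| <= 1 -> M (S f).
  by move=> f1; split=> [|t t1]; [exact: hS|exact: SA].
have MA : M `<=` A by exact: maximal_prism_sub.
have hL x : x \in <<xs>>%VS -> h x = 0.
  move=> /coord_span->; rewrite linear_sum big1// => i _.
  by rewrite linearZZ -tnth_nth h_xs scaler0.
have DL : D `<=` translate <<xs>>%VS 0.
  move=> d [hd _]; exists d; last by rewrite add0r.
  (* In the given basis [h] reads off the coefficient of [x1], so its kernel is the span of [xs]. *)
  have : d \in <<x1 :: xs>>%VS.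
    by move/andP: x_basis => [/eqP-> _]; exact: memvf.
  rewrite span_cons => /memv_addP[_ /vlineP[a ->] [y yL dE]].
  move: hd; rewrite dE linearD linearZZ (hL _ yL) h_x1.2 addr0.
  by rewrite [_ *: _]mulr1 => ->; rewrite scale0r add0r.
exists D, M; split=> //.
- exists <<xs>>%VS, 0, (- p), p; split=> //; last exact: maximal_prismE.
    have /andP[/eqP x_span x_free] := x_basis.
    have xs_free : free xs by move: x_free; rewrite free_cons => /andP[].
    rewrite /hyperplane (eqP xs_free) -x_span; move/eqP: x_free => -> /=.
    by [].
  (* The segment has direction [2 p], where [h] is 2, while [h] vanishes on the span. *)
  apply/negP => /hL; rewrite linearB linearN hp opprK => /eqP.
  by rewrite -[_ + _]/(2%:R) pnatr_eq0.
- exact: maximal_prism_symmetric.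
- by exists 0.
split.
  split.
  - by case: Ab => C [Cr Ale]; exists C; split=> // r rC x /MA; exact: Ale.
  - by apply: maximal_prism_closed => //; exact: h_x1.1.1.
  - exact: maximal_prism_convex.
  (* [M] contains the open unit ball of [X], because [x = S (E x)] and [E] is isometric. *)
  - exists 0; rewrite /interior; apply/nbhs_ballP; exists 1 => //= x.
    rewrite -ball_normE/= sub0r normrN => x_lt1; rewrite -(SE x); apply: SM.
    by rewrite canonical_embedding_norm ltW.
  - exact: maximal_prism_symmetric.
move=> Y i i_iso; have [T [TE T1]] := canonical_embedding_extends x1 i_iso.
(* [T] maps the unit ball of [Y] into that of the function space, which [S] maps into [M]. *)
have /linear_functionP[Q QE] : linear (S \o T).
  by move=> a y z; rewrite /= !linearP.
have QM y : `|y| <= 1 -> M (Q y).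
  by move=> y1; rewrite QE; apply: SM; exact: le_trans (T1 y) y1.
exists Q; split=> [|x|_ [y y1 <-]]; last exact: QM.
- have [C [_ Ale]] := Ab.
  apply: (@linear_ler_continuous _ _ _ _ (C + 1)).
  apply: linear_unit_ball_bound => y /QM/MA.
  by apply: Ale; rewrite ltrDl.
- by rewrite QE /= TE SE.
Qed.
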